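(* Let $R=R(A_1,S)$ be an extended affine root system of type $A_1$ with extended affine Weyl group $\mathcal W$, and suppose any one of the following holds: (i) there exists $J\in\mathrm{Esupp}(S)$ such that $\{r,s\}\in\mathrm{supp}(S)$ for all $r,s\in J$; (ii) $S$ is a lattice of rank $\ge 3$; (iii) $\nu=\mathrm{rank}(S)>3$ and $\mathrm{ind}(S)=2^\nu-2$. Then $\mathcal W$ does not have the presentation by conjugation.
   Context: Semilattices. Let $\mathcal V^0$ be a finite dimensional real vector space of dimension $\nu$. A semilattice in $\mathcal V^0$ is a subset $S\subseteq\mathcal V^0$ such that $0\in S$, $S\pm 2S\subseteq S$, $S$ spans $\mathcal V^0$ and $S$ is discrete in $\mathcal V^0$; its rank is $\nu$, and it is a lattice if moreover $S\pm S\subseteq S$. The $\mathbb Z$-span $\Lambda$ of $S$ is a lattice in $\mathcal V^0$ having a $\mathbb Z$-basis contained in $S$; fix such a basis $\{\sigma_1,\ldots,\sigma_\nu\}\subseteq S$. For $J\subseteq J_\nu:=\{1,\ldots,\nu\}$ put $\tau_J:=\sum_{j\in J}\sigma_j$ ($\tau_\emptyset=0$). $\mathrm{supp}(S)$ is the unique collection of subsets of $J_\nu$ with $\emptyset\in\mathrm{supp}(S)$ and $S=\bigcup_{J\in\mathrm{supp}(S)}(\tau_J+2\Lambda)$. Put $\mathrm{Esupp}(S)=\{J\in\mathrm{supp}(S): |J|\ge 3\}$ and $\mathrm{ind}(S)=|\mathrm{supp}(S)|-1$. Root system and Weyl group. Let $\mathcal V=\mathbb R\alpha_1\oplus\mathcal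 V^0$ with the positive semi-definite symmetric bilinear form having radical $\mathcal V^0$ and $(\alpha_1,\alpha_1)=2$. The extended affine root system $R=R(A_1,S)$ of type $A_1$ and nullity $\nu$ is $R=(S+S)\cup(\pm\alpha_1+S)$, with $S$ a semilattice in $\mathcal V^0$, and $R^\times=\pm\alpha_1+S$ is its set of non-isotropic elements. Let $\tilde{\mathcal V}=\mathcal V\oplus(\mathcal V^0)^*$ with the non-degenerate symmetric form extending that of $\mathcal V$ such that $(\alpha_1,(\mathcal V^0)^* )=((\mathcal V^0)^*,(\mathcal V^0)^* )=0$ and $(\sigma_i,\lambda_j)=\delta_{i,j}$ for a basis $\{\lambda_1,\ldots,\lambda_\nu\}$ of $(\mathcal V^0)^*$. The extended affine Weyl group $\mathcal W$ is the subgroup of the orthogonal group of $\tilde{\mathcal V}$ generated by the reflections $w_\alpha(u)=u-(u,\alpha)\alpha$, $\alpha\in R^\times$. Presentation by conjugation. $\hat{\mathcal W}$ is the group with generators $\hat w_\alpha$, $\alpha\in R^\times$, and relations $\hat w_\alpha^2=1$ and $\hat w_\alpha\hat w_\beta\hat w_\alpha=\hat w_{w_\alpha(\beta)}$ ($\alpha,\beta\in R^\times$). $\mathcal W$ has the presentation by conjugation if $\mathcal W\cong\hat{\mathcal W}$. *)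

(* Defs.v *)
From HB Require Import structures.
From mathcomp Require Import all_boot all_order all_algebra generic_quotient.
From mathcomp Require Import boolp classical_sets reals topology normedtype.
From mathcomp Require Import ring.
Set Implicit Arguments.
Unset Strict Implicit.
Unset Printing Implicit Defensive.
Import Order.TTheory GRing.Theory Num.Theory.
Import numFieldNormedType.Exports.
Local Open Scope classical_set_scope.
Local Open Scope ring_scope.

Definition isog (G H : groupType) : Prop :=
  exists f : {multiplicative G -> H}, bijective f.

Section GeneratedSubgroup.
Variables (G : groupType) (A : set G).
Local Open Scope group_scope.

Definition subgroup (H : set G) : Prop :=
  [/\ H 1, forall x y, H x -> H y -> H (x * y) & forall x, H x -> H x^-1].

Definition generated : set G :=
  [set g | forall H : set G, subgroup H -> A `<=` H -> H g].

Lemma generated_subgroup : subgroup generated.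
Proof.
split=> [H [] //|x y gx gy H sH AH|x gx H sH AH]; case: (sH) => _ HM HV.
- by apply: HM; [apply: gx|apply: gy].
- by apply: HV; apply: gx.
Qed.

Lemma sub_generated : A `<=` generated.
Proof. by move=> x Ax H _; apply. Qed.

Definition genGroup : Type := {g : G | g \in generated}.

HB.instance Definition _ := SubChoice.on genGroup.

Fact genGroup_closed : group_closed (mem generated).
Proof.
have [g1 gM gV] := generated_subgroup.
split=> [|x y]; first exact: (mem_set g1).
by move=> /set_mem gx /set_mem gy; apply: mem_set (gM _ _ gx (gV _ gy)).
Qed.

HB.instance Definition _ :=
  SubChoice_isSubGroup.Build G (mem generated) genGroup genGroup_closed.

End GeneratedSubgroup.

(* The group presented by generators X and relations u = v, for rel u v: words *)
(* in letters (x, b), standing for x if b = true and for x^-1 if b = false,    *)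
(* modulo the congruence generated by free cancellation and rel.               *)
Section Presentation.
Variables (X : choiceType) (rel : seq (X * bool) -> seq (X * bool) -> Prop).
Implicit Types u v w : seq (X * bool).

Inductive pres_eq : seq (X * bool) -> seq (X * bool) -> Prop :=
| pres_refl u : pres_eq u u
| pres_sym u v : pres_eq u v -> pres_eq v u
| pres_trans u v w : pres_eq u v -> pres_eq v w -> pres_eq u w
| pres_cat u u' v v' : pres_eq u u' -> pres_eq v v' ->
    pres_eq (u ++ v) (u' ++ v')
| pres_cancel x b : pres_eq [:: (x, b); (x, ~~ b)] [::]
| pres_rel u v : rel u v -> pres_eq u v.

Definition pres_eqb u v := `[< pres_eq u v >].

Fact pres_eqb_refl : reflexive pres_eqb.
Proof. by move=> u; apply/asboolP/pres_refl. Qed.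

Fact pres_eqb_sym : symmetric pres_eqb.
Proof. by move=> u v; apply/asboolP/asboolP; apply: pres_sym. Qed.

Fact pres_eqb_trans : transitive pres_eqb.
Proof.
by move=> v u w /asboolP uv /asboolP vw; apply/asboolP/(pres_trans uv vw).
Qed.

Canonical pres_equiv :=
  EquivRel pres_eqb pres_eqb_refl pres_eqb_sym pres_eqb_trans.

Definition presented := {eq_quot pres_equiv}%qT.

HB.instance Definition _ := Choice.on presented.

Definition pres_class u : presented := (\pi_({eq_quot pres_equiv}) u)%qT.
Definition pres_word (a : presented) : seq (X * bool) :=
  repr (a : {eq_quot pres_equiv}%qT).

Definition pres_gen (x : X) : presented := pres_class [:: (x, true)].

Definition inv_word u := rev [seq (l.1, ~~ l.2) | l <- u].

Definition pres_one := pres_class [::].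
Definition pres_mul a b := pres_class (pres_word a ++ pres_word b).
Definition pres_inv a := pres_class (inv_word (pres_word a)).

Lemma pres_classP u v : pres_class u = pres_class v <-> pres_eq u v.
Proof.
split=> [/eqP|uv]; first by rewrite eqmodE => /asboolP.
by apply/eqP; rewrite eqmodE; apply/asboolP.
Qed.

Lemma pres_wordK : cancel pres_word pres_class.
Proof. by move=> a; rewrite /pres_class /pres_word reprK. Qed.

Lemma pres_classK u : pres_eq (pres_word (pres_class u)) u.
Proof. by apply/pres_classP; rewrite pres_wordK. Qed.

Lemma pres_class_cat u v :
  pres_mul (pres_class u) (pres_class v) = pres_class (u ++ v).
Proof. by apply/pres_classP/pres_cat; apply: pres_classK. Qed.

Lemma pres_inv_word u : pres_eq (inv_word u ++ u) [::].
Proof.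
elim: u => [|[x b] u IHu]; first exact: pres_refl.
rewrite /inv_word /= rev_cons cat_rcons.
apply: pres_trans IHu.
have c := pres_cancel x (~~ b); rewrite negbK in c.
exact: (pres_cat (pres_refl _) (pres_cat c (pres_refl u))).
Qed.

Lemma inv_wordK : involutive inv_word.
Proof.
move=> u; rewrite /inv_word map_rev revK -map_comp -[RHS]map_id.
by apply: eq_map => -[x b] /=; rewrite negbK.
Qed.

Fact pres_mulA : associative pres_mul.
Proof.
move=> a b c; rewrite -(pres_wordK a) -(pres_wordK b) -(pres_wordK c).
by rewrite !pres_class_cat catA.
Qed.

Fact pres_mul1 : left_id pres_one pres_mul.
Proof. by move=> a; rewrite -(pres_wordK a) pres_class_cat. Qed.

Fact pres_mulr1 : right_id pres_one pres_mul.
Proof. by move=> a; rewrite -(pres_wordK a) pres_class_cat cats0. Qed.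

Fact pres_mulV : left_inverse pres_one pres_inv pres_mul.
Proof.
move=> a; rewrite -[X in pres_mul _ X]pres_wordK pres_class_cat.
exact/pres_classP/pres_inv_word.
Qed.

Fact pres_mulrV : right_inverse pres_one pres_inv pres_mul.
Proof.
move=> a; rewrite -[X in pres_mul X]pres_wordK pres_class_cat.
apply/pres_classP; rewrite -[X in X ++ _]inv_wordK; exact: pres_inv_word.
Qed.

HB.instance Definition _ := isGroup.Build presented
  pres_mulA pres_mul1 pres_mulr1 pres_mulV pres_mulrV.

End Presentation.

Section OrthogonalGroup.
Variables (K : fieldType) (E : vectType K) (B : E -> E -> K).

Definition orthogonal (f : 'End(E)) : bool :=
  (lker f == 0%VS) && `[< forall u v, B (f u) (f v) = B u v >].

Definition orthGroup : Type := {f : 'End(E) | orthogonal f}.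

HB.instance Definition _ := SubChoice.on orthGroup.

Fact orth1 : orthogonal \1%VF.
Proof.
apply/andP; split; first by apply/lker0P=> u v; rewrite !id_lfunE.
by apply/asboolP=> u v; rewrite !id_lfunE.
Qed.

Fact orthM (f g : orthGroup) : orthogonal (val f \o val g)%VF.
Proof.
have /andP[/lker0P f0 /asboolP fB] := valP f.
have /andP[/lker0P g0 /asboolP gB] := valP g.
apply/andP; split; first by apply/lker0P=> u v; rewrite !comp_lfunE => /f0/g0.
by apply/asboolP=> u v; rewrite !comp_lfunE fB gB.
Qed.

Lemma orthVK (f : orthGroup) : cancel (val f)^-1%VF (val f).
Proof. by have /andP[f0 _] := valP f; apply: lker0_lfunVK. Qed.

Fact orthV (f : orthGroup) : orthogonal (val f)^-1%VF.
Proof.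
have /andP[_ /asboolP fB] := valP f.
apply/andP; split; first exact/lker0P/can_inj/orthVK.
by apply/asboolP=> u v; rewrite -fB !orthVK.
Qed.

Definition orth_one : orthGroup := Sub \1%VF orth1.
Definition orth_mul (f g : orthGroup) : orthGroup := Sub _ (orthM f g).
Definition orth_inv (f : orthGroup) : orthGroup := Sub _ (orthV f).

Fact orth_mulA : associative orth_mul.
Proof. by move=> f g h; apply: val_inj; rewrite /= comp_lfunA. Qed.

Fact orth_mul1 : left_id orth_one orth_mul.
Proof. by move=> f; apply: val_inj; rewrite /= comp_lfun1l. Qed.

Fact orth_mulr1 : right_id orth_one orth_mul.
Proof. by move=> f; apply: val_inj; rewrite /= comp_lfun1r. Qed.

Fact orth_mulV : left_inverse orth_one orth_inv orth_mul.
Proof.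
move=> f; apply: val_inj => /=; have /andP[f0 _] := valP f.
exact: lker0_compVf.
Qed.

Fact orth_mulrV : right_inverse orth_one orth_inv orth_mul.
Proof.
move=> f; apply: val_inj => /=; have /andP[f0 _] := valP f.
exact: lker0_compfV.
Qed.

HB.instance Definition _ := isGroup.Build orthGroup
  orth_mulA orth_mul1 orth_mulr1 orth_mulV orth_mulrV.

End OrthogonalGroup.

Section Semilattice.
Variables (R : realType) (V0 : vectType R).
Implicit Types (S L : set V0).

Definition spanning S : Prop :=
  forall v : V0, exists2 X : seq V0, {in X, forall x, S x} & v \in <<X>>%VS.

(* The topology of V0 is that of 'rV_n, transported by coordinates in a basis; *)
(* it does not depend on the basis.                                            *)
Definition coords (v : V0) : 'rV[R]_(\dim {: V0}) :=
  \row_i coord (vbasis {: V0}) i v.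

Definition discrete S : Prop :=
  forall x, S x -> isolated (coords @` S) (coords x).

Definition semilattice S : Prop :=
  [/\ S 0,
      forall s t, S s -> S t -> S (s + t *+ 2) /\ S (s - t *+ 2),
      spanning S
    & discrete S].

Definition lattice S : Prop :=
  semilattice S /\ forall s t, S s -> S t -> S (s + t) /\ S (s - t).

Definition Zspan S : set V0 :=
  [set v | exists n (c : 'I_n -> int) (s : 'I_n -> V0),
     (forall i, S (s i)) /\ v = \sum_i s i *~ c i].

Variable nu : nat.
Implicit Types (sigma : 'I_nu -> V0) (P : {set {set 'I_nu}}).

Definition Zbasis sigma L : Prop :=
  L = Zspan (range sigma) /\
  forall c : 'I_nu -> int, \sum_i sigma i *~ c i = 0 -> forall i, c i = 0.

Definition tau sigma (J : {set 'I_nu}) : V0 := \sum_(j in J) sigma j.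

(* P is the (unique) collection supp(S) relative to the basis sigma. *)
Definition is_supp S sigma P : Prop :=
  finset.set0 \in P /\
  S = \bigcup_(J in [set` P]) [set tau sigma J + v *+ 2 | v in Zspan S].

Definition Esupp P : {set {set 'I_nu}} := [set J in P | (3 <= #|J|)%N]%SET.

Definition ind P : nat := (#|P| - 1)%N.

End Semilattice.

Section RootSystem.
Variables (R : realType) (V0 : vectType R).

(* V = R alpha_1 + V0, and V~ = V + V0^*. *)
Local Notation V := (R^o * V0)%type.
Local Notation Vt := ((R^o * V0) * 'Hom(V0, R^o))%type.

Definition alpha1 : V := (1, 0).
Definition inV (s : V0) : V := (0, s).
Definition inVt (a : V) : Vt := (a, 0).

Definition form (a b : V) : R := 2 * a.1 * b.1.

(* V0 and V0^* are paired by evaluation, i.e. (sigma_i, lambda_j) = delta_ij   *)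
(* for any basis sigma of V0 and its dual basis lambda.                        *)
Definition formt (u v : Vt) : R := form u.1 v.1 + v.2 u.1.2 + u.2 v.1.2.

Definition EARS (S : set V0) : set V :=
  [set inV (s + t) | s in S & t in S]
  `|` [set alpha1 + inV s | s in S] `|` [set - alpha1 + inV s | s in S].

Definition nonisotropic (S : set V0) : set V :=
  [set a | EARS S a /\ form a a != 0].

Lemma nonisotropicE (S : set V0) : nonisotropic S =
  [set alpha1 + inV s | s in S] `|` [set - alpha1 + inV s | s in S].
Proof.
apply/seteqP; split=> [a [[[[s _ [t _ <-]]|[s Ss <-]]|[s Ss <-]]]|a].
- by rewrite /form /= !mulr0 eqxx.
- by left; exists s.
- by right; exists s.
move=> [] [s Ss <-]; split; do ?by [left; right; exists s|right; exists s].
- by rewrite /form /= !addr0 !mulr1 pnatr_eq0.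
- by rewrite /form /= !addr0 !(mulrN1, mulrN, mulNr, mulr1) opprK pnatr_eq0.
Qed.

Definition wfun (a : V) (u : Vt) : Vt := u - formt u (inVt a) *: inVt a.

Lemma formt_linearl k u v x : formt (k *: u + v) x = k * formt u x + formt v x.
Proof.
rewrite /formt /form /= linearP add_lfunE scale_lfunE /= /GRing.scale /=.
by ring.
Qed.

Lemma formtC u v : formt u v = formt v u.
Proof. by rewrite /formt /form; ring. Qed.

Fact wfun_is_linear a : linear (wfun a).
Proof.
move=> k u v; rewrite /wfun formt_linearl scalerDl opprD addrACA.
by rewrite scalerBr scalerA.
Qed.

HB.instance Definition _ a :=
  GRing.isLinear.Build R Vt Vt *:%R (wfun a) (wfun_is_linear a).

Definition reflection (a : V) : 'End(Vt) := linfun (wfun a).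

Lemma reflectionE a u : reflection a u = wfun a u. Proof. by rewrite lfunE. Qed.

Lemma nonisotropic_norm (S : set V0) a : nonisotropic S a -> form a a = 2.
Proof.
rewrite nonisotropicE => -[] [s Ss <-]; rewrite /form /=; ring.
Qed.

Lemma reflection_orthogonal (S : set V0) a :
  nonisotropic S a -> orthogonal formt (reflection a).
Proof.
move=> /nonisotropic_norm aa.
have ata : formt (inVt a) (inVt a) = 2.
  by rewrite /formt /= lfunE /= aa !addr0.
have wl u x :
    formt (reflection a u) x = formt u x - formt u (inVt a) * formt (inVt a) x.
  by rewrite reflectionE /wfun addrC -scaleNr formt_linearl; ring.
apply/andP; split; last first.
  by apply/asboolP=> u v; rewrite wl [formt u _]formtC [formt (inVt a) _]formtC
    !wl ata [formt u v]formtC [formt (inVt a) u]formtC; ring.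
apply/lker0P/(@can_inj _ _ _ (reflection a)) => u.
rewrite [LHS]reflectionE /wfun wl ata reflectionE /wfun -addrA -opprD -scalerDl.
have -> : formt u (inVt a) + (formt u (inVt a) - formt u (inVt a) * 2) = 0.
  by ring.
by rewrite scale0r subr0.
Qed.

Lemma nonisotropic_w (S : set V0) a b : semilattice S ->
    nonisotropic S a -> nonisotropic S b ->
  exists2 c, nonisotropic S c & inVt c = reflection a (inVt b).
Proof.
move=> [_ S2 _ _]; rewrite !nonisotropicE => Sa Sb.
have wb : reflection a (inVt b) = inVt (b - form b a *: a).
  rewrite reflectionE /wfun /formt /= !lfunE /= !addr0.
  by congr pair; rewrite /= scaler0 subr0.
exists (b - form b a *: a) => //; clear wb.
have pairE (x y : V) : x.1 = y.1 -> x.2 = y.2 -> x = y.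
  by case: x y => [? ?] [? ?] /= -> ->.
case: Sa => -[s Ss <-]; case: Sb => -[t St <-]; rewrite /form /=.
- right; exists (t - s *+ 2); first by have [] := S2 _ _ St Ss.
  apply: pairE => /=; first by rewrite /GRing.scale /=; ring.
  by rewrite ?oppr0 !add0r !addr0 ?mulrNN ?mulrN !mulr1 ?scaleNr ?opprK
    scaler_nat.
- left; exists (t + s *+ 2); first by have [] := S2 _ _ St Ss.
  apply: pairE => /=; first by rewrite /GRing.scale /=; ring.
  by rewrite ?oppr0 !add0r !addr0 ?mulrNN ?mulrN !mulr1 ?scaleNr ?opprK
    scaler_nat.
- right; exists (t + s *+ 2); first by have [] := S2 _ _ St Ss.
  apply: pairE => /=; first by rewrite /GRing.scale /=; ring.
  by rewrite ?oppr0 !add0r !addr0 ?mulrNN ?mulrN !mulr1 ?scaleNr ?opprK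
    scaler_nat.
- left; exists (t - s *+ 2); first by have [] := S2 _ _ St Ss.
  apply: pairE => /=; first by rewrite /GRing.scale /=; ring.
  by rewrite ?oppr0 !add0r !addr0 ?mulrNN ?mulrN !mulr1 ?scaleNr ?opprK
    scaler_nat.
Qed.

Definition reflections (S : set V0) : set (orthGroup formt) :=
  [set g | exists2 a, nonisotropic S a & val g = reflection a].

Definition weylGroup (S : set V0) : groupType := genGroup (reflections S).

Definition rootType (S : set V0) : choiceType := {a : V | a \in nonisotropic S}.

(* In conj_rel_conj, c is the root w_a(b), which exists by nonisotropic_w. *)
Variant conj_rel (S : set V0) :
    seq (rootType S * bool) -> seq (rootType S * bool) -> Prop :=
| conj_rel_sq (a : rootType S) : conj_rel [:: (a, true); (a, true)] [::]
| conj_rel_conj (a b c : rootType S) :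
    inVt (val c) = reflection (val a) (inVt (val b)) ->
    conj_rel [:: (a, true); (b, true); (a, true)] [:: (c, true)].

Definition conjGroup (S : set V0) : groupType := presented (@conj_rel S).

Definition presentation_by_conjugation (S : set V0) : Prop :=
  isog (weylGroup S) (conjGroup S).

End RootSystem.

(* Main.v *)
(* Compare characters with values in Z/2 rather than the groups themselves.   *)
(* The defining relations of the presented group only identify generators     *)
(* whose isotropic parts agree up to sign modulo 2 Lambda, so every function  *)
(* on supp(S) is a character of it. A character of W is also determined by    *)
(* its values on the reflections w_J in alpha_1 + tau_J, J in supp(S), but    *)
(* these values are not arbitrary: in the Heisenberg group the translation    *)
(* w_J w_0 by tau_J is the product of the translations by the sigma_j, j in   *)
(* J, and of central factors, one for each pair {i, j} in J, which are        *)
(* products of reflections in alpha_1 + s for s = 0, sigma_i, sigma_j and     *)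
(* sigma_i + sigma_j. So, when |J| >= 3, no character of W is nontrivial      *)
(* exactly at w_J; thus W has fewer characters than the presented group, and  *)
(* no isomorphism exists, whether natural or not.                             *)
(*                                                                            *)
(* In cases (ii) and (iii) some J with |J| >= 3 has all its subsets in        *)
(* supp(S): in (iii) supp(S) misses only one set M, and J only has to avoid   *)
(* one point of M.                                                            *)

Require Import Defs.
From mathcomp Require Import all_boot all_order all_algebra.
From mathcomp Require Import boolp classical_sets reals topology normedtype.
From mathcomp Require Import ring zify.
Import Order.TTheory GRing.Theory Num.Theory.
Local Open Scope ring_scope.

(** Suppose that W and the presented group are isomorphic. Subsets of supp(S) give distinct
    characters of the presented group ([class_char], [class_char_gen]), while a character of W is
    fixed by its values at the reflections in [alpha1 + tau_J], J in supp(S) ([char_ext]). Pulling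
    back and counting, every prescription of these values is attained ([supp_char]), in particular
    the one supported at a single J with at least three elements. When the singletons and pairs in J
    lie in supp(S), the kernel of that character contains their reflections, hence also the one in
    [alpha1 + tau_J] by [refl_sum]: a contradiction ([pairs_not_presented]). *)

(** * Congruence modulo twice the lattice *)

Section Zspan.
Context {R : realType} {V0 : vectType R}.
Implicit Types (S : set V0) (v : V0).

Lemma Zspan_ind S (P : V0 -> Prop) :
    P 0 -> (forall u v, P u -> P v -> P (u + v)) ->
    (forall v, P v -> P (- v)) ->
    (forall s, S s -> P s) ->
  forall v, Zspan S v -> P v.
Proof.
move=> P0 PD PN PS v [n [c [s [Ss ->]]]].
have PMn (u : V0) m : P u -> P (u *+ m).
  by move=> Pu; elim: m => [|m IHm]; rewrite ?mulr0n // mulrS; apply: PD.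
apply: (big_ind P) => // i _; case: (c i) => m; first exact/PMn/PS.
by rewrite NegzE mulrNz; apply/PN/PMn/PS.
Qed.

Lemma Zspan0 S : Zspan S 0.
Proof.
exists 0%N, (fun=> 0), (fun=> 0); split=> [[]//|].
by rewrite big_ord0.
Qed.

Lemma ZspanD S u v : Zspan S u -> Zspan S v -> Zspan S (u + v).
Proof.
move=> [m [c [s [Ss ->]]]] [n [d [t [St ->]]]].
exists (m + n)%N, (fun i => match split i with inl j => c j | inr j => d j end).
exists (fun i => match split i with inl j => s j | inr j => t j end).
split=> [i|]; first by case: (split i).
rewrite big_split_ord; congr (_ + _); apply: eq_bigr => i _.
  by rewrite -[lshift n i]/(unsplit (inl i)) unsplitK.
by rewrite -[rshift m i]/(unsplit (inr i)) unsplitK.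
Qed.

Lemma ZspanN S v : Zspan S v -> Zspan S (- v).
Proof.
move=> [m [c [s [Ss ->]]]]; exists m, (fun i => - c i), s; split=> //.
by rewrite -sumrN; apply: eq_bigr => i _; rewrite mulrNz.
Qed.

Lemma sub_Zspan S v : S v -> Zspan S v.
Proof. by exists 1%N, (fun=> 1), (fun=> v); rewrite big_ord1. Qed.

Definition congr2 S u v : Prop := exists2 w, Zspan S w & u = v + w *+ 2.

Lemma congr2_refl S v : congr2 S v v.
Proof. by exists 0; rewrite ?mul0rn ?addr0 //; apply: Zspan0. Qed.

Lemma congr2_sym S u v : congr2 S u v -> congr2 S v u.
Proof.
by move=> [w Sw ->]; exists (- w); rewrite ?mulNrn ?addrK //; apply: ZspanN.
Qed.

Lemma congr2_trans S u v w : congr2 S u v -> congr2 S v w -> congr2 S u w.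
Proof.
move=> [x Sx ->] [y Sy ->]; exists (y + x); first exact: ZspanD.
by rewrite -addrA -mulrnDl.
Qed.

Section Basis.
Context {nu : nat} {S : set V0} {sigma : 'I_nu -> V0}.
Hypothesis Sb : Zbasis sigma (Zspan S).

Lemma Zbasis_coord v : Zspan S v ->
  exists d : 'I_nu -> int, v = \sum_i sigma i *~ d i.
Proof.
have [-> _] := Sb; move: v.
pose P v := exists d : 'I_nu -> int, v = \sum_i sigma i *~ d i.
apply: (@Zspan_ind _ P).
- by exists (fun=> 0); rewrite big1.
- move=> _ _ [c ->] [d ->]; exists (fun i => c i + d i).
  by rewrite -big_split; apply: eq_bigr => i _; rewrite mulrzDr.
- move=> _ [c ->]; exists (fun i => - c i).
  by rewrite -sumrN; apply: eq_bigr => i _; rewrite mulrNz.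
move=> _ [i _ <-]; exists (fun j => (j == i)%:Z).
rewrite (bigD1 i) //= eqxx big1 ?addr0 // => j /negPf->.
by rewrite mulr0z.
Qed.

(** The coordinates of [tau sigma J] are 0 or 1, so their parities determine J. *)
Lemma tau_congr2_inj (J K : {set 'I_nu}) :
  congr2 S (tau sigma J) (tau sigma K) -> J = K.
Proof.
move=> [_ /Zbasis_coord[d ->] JK]; have [_ sigma_free] := Sb.
have tauE (I : {set 'I_nu}) : tau sigma I = \sum_i sigma i *~ (i \in I)%:Z.
  rewrite /tau big_mkcond; apply: eq_bigr => i _.
  by case: (i \in I); rewrite ?mulr0z.
apply/setP => i.
suff /sigma_free/(_ i) : \sum_j sigma j *~
    ((j \in J)%:Z - (j \in K)%:Z - d j * 2) = 0.
  by case: (i \in J); case: (i \in K); lia.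
transitivity (tau sigma J - tau sigma K - (\sum_j sigma j *~ d j) *+ 2).
  rewrite !tauE -sumrMnl -!sumrB; apply: eq_bigr => j _.
  by rewrite !mulrzBr mulrzA.
by rewrite JK -addrA -opprD subrr.
Qed.

End Basis.
End Zspan.

(** * Characters of a presented group with values in Z/2 *)

Section Parity.
Context {X : choiceType} {rel : seq (X * bool) -> seq (X * bool) -> Prop}.
Variable p : X -> bool.

(** A letter and its inverse contribute alike, since every element of Z/2 is its own opposite. *)
Definition parity (u : seq (X * bool)) : bool :=
  \big[addb/false]_(l <- u) p l.1.

Hypothesis parity_rel : forall u v, rel u v -> parity u = parity v.

Lemma parity_cat u v : parity (u ++ v) = parity u (+) parity v.
Proof. by rewrite /parity big_cat. Qed.

Lemma parity_pres_eq u v : pres_eq rel u v -> parity u = parity v.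
Proof.
elim=> // {u v} [u v w _ -> _ ->|u u' v v' _ uu' _ vv'|x b] //.
  by rewrite !parity_cat uu' vv'.
by rewrite /parity !big_cons big_nil addbF addbb.
Qed.

Definition pres_parity (a : presented rel) : bool := parity (pres_word a).

Lemma pres_parityM a b :
  pres_parity (a * b)%g = pres_parity a (+) pres_parity b.
Proof. by rewrite -parity_cat; apply/parity_pres_eq/pres_classK. Qed.

Lemma pres_parity_gen x : pres_parity (pres_gen rel x) = p x.
Proof.
rewrite [LHS](parity_pres_eq _ _ (pres_classK _ _)).
by rewrite /parity big_cons big_nil addbF.
Qed.

End Parity.

(** * Reflections and the Heisenberg-like group that they generate *)

Section Weyl.
Context {R : realType} {V0 : vectType R}.
Local Open Scope classical_set_scope.
Local Notation Vt := ((R^o * V0) * 'Hom(V0, R^o))%type.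
Local Notation O := (orthGroup (@formt R V0)).
Implicit Types (a b c s t : V0) (u : Vt) (H : set O).

(** Reduces identities between vectors to scalar ones, which [ring] can decide. *)
Lemma Hom_separates a b : (forall f : 'Hom(V0, R^o), f a = f b) -> a = b.
Proof.
move=> ab; rewrite (coord_vbasis (memvf a)) (coord_vbasis (memvf b)).
apply: eq_bigr => i _; congr (_ *: _).
by have := ab (linfun (coord (vbasis {: V0}) i : V0 -> R^o)); rewrite !lfunE.
Qed.

Lemma root_nonisotropic s : nonisotropic setT (alpha1 V0 + inV s).
Proof. by rewrite nonisotropicE; left; exists s. Qed.

(** Taking [setT] for the semilattice makes [refl] total on V0, so that identities between
    reflections carry no membership conditions. *)
Definition refl s : O :=
  Sub (reflection (alpha1 V0 + inV s))
    (reflection_orthogonal (root_nonisotropic s)).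

Lemma reflE s u : val (refl s) u =
  ((- u.1.1 - u.2 s, u.1.2 - (2 * u.1.1 + u.2 s) *: s), u.2).
Proof.
case: u => [[k v] l]; rewrite reflectionE /wfun /formt /Defs.form /= lfunE /=.
congr pair; last by rewrite /= scaler0 subr0.
rewrite !addr0 mulr1 add0r; congr pair => /=; last by rewrite add0r.
by rewrite /GRing.scale /=; ring.
Qed.

Lemma reflectionN (x : R^o * V0) : reflection (- x) = reflection x.
Proof.
apply/lfunP => u; rewrite !reflectionE /wfun.
have -> : inVt (- x) = - inVt x by rewrite /inVt; congr pair; rewrite oppr0.
have -> : formt u (- inVt x) = - formt u (inVt x).
  by rewrite formtC -scaleN1r -[_ *: _]addr0 formt_linearl formtC
     [formt 0 u]/formt /Defs.form /= lfunE /= linear0 mulN1r mulr0 mul0r !addr0.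
by rewrite scalerN scaleNr opprK.
Qed.

Lemma orth_mulE (g h : O) u : val (g * h)%g u = val g (val h u).
Proof. by rewrite /= comp_lfunE. Qed.

Lemma orth_ext (g h : O) : (forall u, val g u = val h u) -> g = h.
Proof. by move=> gh; apply/val_inj/lfunP. Qed.

Lemma refl_conj s t : (refl s * refl t * refl s)%g = refl (s *+ 2 - t).
Proof.
apply: orth_ext => -[[k v] l]; rewrite !orth_mulE !reflE /=; congr pair.
have -> : l (s *+ 2 - t) = 2 * l s - l t.
  by rewrite linearB linearMn mulr_natl.
congr pair; first by ring.
apply: Hom_separates => f.
by rewrite !(linearB, linearZ, linearMn) /= /GRing.scale /=; ring.
Qed.

Lemma refl_sq s : (refl s * refl s)%g = 1%g.
Proof.
apply: orth_ext => -[[k v] l]; rewrite !orth_mulE !reflE [RHS]id_lfunE /=.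
congr pair; congr pair; first by ring.
apply: Hom_separates => f.
by rewrite !(linearB, linearZ) /= /GRing.scale /=; ring.
Qed.

(** These are plain maps, so that their identities require no proof of linearity or orthogonality.
    [central] is alternating and biadditive in [a] and [b], commutes with each [transl], and
    measures the failure of [transl] to be additive. *)
Definition transl a u : Vt :=
  ((u.1.1 - u.2 a, u.1.2 + (2 * u.1.1 - u.2 a) *: a), u.2).
Definition central a b u : Vt :=
  ((u.1.1, u.1.2 + u.2 a *: b - u.2 b *: a), u.2).

Lemma refl_transl s u : val (refl s * refl 0)%g u = transl s u.
Proof.
case: u => [[k v] l]; rewrite orth_mulE !reflE /transl /= linear0 subr0 opprK.
congr pair; congr pair.
apply: Hom_separates => f.
by rewrite !(linearB, linearD, linearZ, linear0) /= /GRing.scale /=; ring.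
Qed.

Lemma translD a b u : transl (a + b) u = transl a (transl b (central b a u)).
Proof.
case: u => [[k v] l]; rewrite /transl /central /= linearD; congr pair.
congr pair; first by ring.
apply: Hom_separates => f.
by rewrite !(linearB, linearD, linearZ) /= /GRing.scale /=; ring.
Qed.

Lemma translK a u : transl a (transl (- a) u) = u.
Proof.
case: u => [[k v] l]; rewrite /transl /= linearN; congr pair.
congr pair; first by ring.
apply: Hom_separates => f.
by rewrite !(linearB, linearD, linearZ, linearN) /= /GRing.scale /=; ring.
Qed.

Lemma centralK a b u : central a b (central b a u) = u.
Proof.
case: u => [[k v] l]; rewrite /central /=; congr pair; congr pair.
apply: Hom_separates => f.
by rewrite !(linearB, linearD, linearZ) /= /GRing.scale /=; ring.
Qed.

Lemma centralD a b c u : central a (b + c) u = central a b (central a c u).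
Proof.
case: u => [[k v] l]; rewrite /central /= linearD; congr pair; congr pair.
apply: Hom_separates => f.
by rewrite !(linearB, linearD, linearZ) /= /GRing.scale /=; ring.
Qed.

Section Subgroup.
Variable H : set O.
Hypothesis sgH : subgroup H.

(** Lets one compute in H with plain maps: an element of [O] is determined by its action. *)
Definition realized (F : Vt -> Vt) : Prop :=
  exists2 g : O, H g & forall u, val g u = F u.

Lemma realized_id F : F =1 id -> realized F.
Proof. by case: sgH => H1 _ _ FE; exists 1%g => // u; rewrite id_lfunE FE. Qed.

Lemma realized_comp F F' G : realized F -> realized F' ->
  (forall u, G u = F (F' u)) -> realized G.
Proof.
case: sgH => _ HM _ [g Hg gF] [h Hh hF'] GE.
by exists (g * h)%g => [|u]; [apply: HM | rewrite orth_mulE hF' gF GE].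
Qed.

Lemma realized_inv F F' : realized F -> cancel F' F -> realized F'.
Proof.
case: sgH => _ _ HV [g Hg gF] F'K; exists g^-1%g => [|u]; first exact: HV.
by rewrite -{1}(F'K u) -gF -orth_mulE mulVg id_lfunE.
Qed.

Lemma realized_transl s : H (refl 0) -> H (refl s) -> realized (transl s).
Proof.
case: sgH => _ HM _ H0 Hs; exists (refl s * refl 0)%g; first exact: HM.
exact: refl_transl.
Qed.

Lemma realized_refl s : H (refl 0) -> realized (transl s) -> H (refl s).
Proof.
case: sgH => _ HM _ H0 [g Hg gE].
have gE' : g = (refl s * refl 0)%g.
  by apply: orth_ext => u; rewrite gE refl_transl.
by rewrite -[refl s]mulg1 -(refl_sq 0) mulgA -gE'; apply: HM.
Qed.

(** By [translD], [central a b] is [transl (- a)] after [transl (- b)] after [transl (b + a)]. *)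
Lemma realized_central a b :
    realized (transl a) -> realized (transl b) -> realized (transl (b + a)) ->
  realized (central a b).
Proof.
move=> ra rb rba; have inv c : realized (transl c) -> realized (transl (- c)).
  by move=> rc; apply: realized_inv rc _; apply: translK.
have rc : realized (transl (- b) \o transl (b + a)).
  exact: realized_comp (inv b rb) rba _.
apply: realized_comp (inv a ra) rc _ => u /=.
have tVK c x : transl (- c) (transl c x) = x by rewrite -{2}[c]opprK translK.
by rewrite translD !tVK.
Qed.

(* In the Heisenberg group the translation by a sum is the product of the      *)
(* translations by its terms, corrected by biadditive central factors, so only *)
(* single terms and pairs of terms are needed.                                 *)
Lemma refl_sum (I : finType) (f : I -> V0) (J : {set I}) :
    H (refl 0) -> (forall i, i \in J -> H (refl (f i))) ->
    (forall i j, i \in J -> j \in J -> i != j -> H (refl (f i + f j))) ->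
  H (refl (\sum_(i in J) f i)).
Proof.
move=> H0 H1 H2; apply: realized_refl => //.
(* Additivity of [central] in its second argument reduces to pairs; [i \notin l] keeps their indices
   distinct. *)
have c_sum i l : i \in J -> {subset l <= J} -> i \notin l ->
    realized (central (f i) (\sum_(j <- l) f j)).
  move=> iJ; elim: l => [_ _|j l IHl lJ].
    apply: realized_id => -[[k v] m].
    by rewrite big_nil /central /= !linear0 scale0r addr0 subr0.
  rewrite inE negb_or => /andP[ij il].
  have jJ : j \in J by apply: lJ; rewrite mem_head.
  apply: (@realized_comp (central (f i) (f j))
    (central (f i) (\sum_(j <- l) f j))) => [||u].
  - apply: realized_central; apply: realized_transl => //.
    + exact: H1.
    + exact: H1.
    + by apply: H2; rewrite // eq_sym.
  - by apply: IHl il => x xl; apply: lJ; rewrite inE xl orbT.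
  - by rewrite big_cons centralD.
rewrite -big_enum /=.
have : {subset enum J <= J} by move=> i; rewrite mem_enum.
elim: (enum J) (enum_uniq J) => [_ _|i l IHl /= /andP[il ul] lJ].
  apply: realized_id => -[[k v] m].
  by rewrite big_nil /transl /= !linear0 !addr0.
have iJ : i \in J by apply: lJ; rewrite mem_head.
have {}lJ : {subset l <= J} by move=> x xl; apply: lJ; rewrite inE xl orbT.
have tl : realized (transl (\sum_(j <- l) f j)) by apply: IHl.
(* Swapping the arguments of [central] inverts it. *)
have cl : realized (central (\sum_(j <- l) f j) (f i)).
  by apply: realized_inv (c_sum _ _ iJ lJ il) _; apply: centralK.
have ti : realized (transl (f i)) by apply: realized_transl => //; apply: H1.
have tcl : realized (transl (\sum_(j <- l) f j) \o
    central (\sum_(j <- l) f j) (f i)) by apply: realized_comp tl cl _.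
rewrite big_cons; apply: realized_comp ti tcl _ => u.
exact: translD.
Qed.

End Subgroup.

Section Reflections.
Context {S : set V0}.
Hypothesis Ssl : semilattice S.

Lemma reflections_refl s : S s -> reflections S (refl s).
Proof.
move=> Ss; exists (alpha1 V0 + inV s) => //.
by rewrite nonisotropicE; left; exists s.
Qed.

Lemma reflectionsP g : reflections S g -> exists2 s, S s & g = refl s.
Proof.
have [S0 S2 _ _] := Ssl.
move=> [a]; rewrite nonisotropicE => -[] [s Ss <-] ga.
  by exists s => //; apply: val_inj.
exists (- s); first by have [_] := S2 _ _ Ss Ss; rewrite mulr2n opprD addNKr.
apply: val_inj; rewrite /= ga -reflectionN opprD opprK.
congr (reflection (_ + _)).
by rewrite /inV; congr pair; rewrite oppr0.
Qed.

(** Conjugating by [refl 0] and then by [refl s] turns [refl r] into [refl (r + s *+ 2)]. Hence one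
    reflection per class modulo 2 Lambda yields all of them. *)
Lemma reflections_normal_sub (H : set O) (T : set V0) :
    (forall s g, S s -> H g -> H (refl s * g * refl s)%g) ->
    (forall s, S s -> exists2 t, T t & congr2 S s t) ->
    T `<=` S -> (forall t, T t -> H (refl t)) ->
  reflections S `<=` H.
Proof.
have [S0 S2 _ _] := Ssl; move=> HN ST TS HT g /reflectionsP[s Ss ->].
have [t Tt [v Sv ->]] := ST s Ss.
(* Quantifying over [r] lets shifts compose, so that [P] is stable under sums. *)
pose P v := forall r, S r -> H (refl r) ->
  S (r + v *+ 2) /\ H (refl (r + v *+ 2)).
suff /(_ t (TS _ Tt) (HT _ Tt))[] : P v by [].
move: v Sv {Ss}.
have opp r : S r -> H (refl r) -> S (- r) /\ H (refl (- r)).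
  move=> Sr Hr; split.
    by have [_] := S2 _ _ Sr Sr; rewrite mulr2n opprD addNKr.
  by have := HN _ _ S0 Hr; rewrite refl_conj mul0rn sub0r.
apply: (@Zspan_ind _ _ _ P).
- by move=> r; rewrite mul0rn addr0.
- move=> x y Px Py r Sr Hr; rewrite mulrnDl addrA.
  by have [] := Px _ Sr Hr; apply: Py.
- move=> w Pw r Sr Hr; have [Sr' Hr'] := opp _ Sr Hr.
  have [Sw Hw] := Pw _ Sr' Hr'.
  by have := opp _ Sw Hw; rewrite opprD opprK -mulNrn.
move=> s' Ss' r Sr Hr; split; first by have [] := S2 _ _ Sr Ss'.
have [_ Hr'] := opp _ Sr Hr.
by have := HN _ _ Ss' Hr'; rewrite refl_conj opprK addrC.
Qed.

End Reflections.
End Weyl.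

(** * Characters of W compared with those of the presented group *)

Section Characters.
Context {R : realType} {V0 : vectType R} {S : set V0}.
Local Open Scope classical_set_scope.
Local Notation O := (orthGroup (@formt R V0)).
Local Notation W := (weylGroup S).
Hypothesis Ssl : semilattice S.
Implicit Types (a b c : R^o * V0) (s t : V0) (w : W) (chi : W -> bool).

Lemma refl_generated s : S s -> refl s \in generated (reflections S).
Proof.
by move=> Ss; apply: mem_set; apply: sub_generated; apply: reflections_refl.
Qed.

(* The value is only meaningful for [s] in [S]; elsewhere it is [1]. *)
Definition wrefl s : W := insubd (1%g : genGroup (reflections S)) (refl s).

Lemma val_wrefl s : S s -> val (wrefl s) = refl s.
Proof. by move=> Ss; rewrite val_insubd refl_generated. Qed.

(** The kernel is taken inside the orthogonal group, where the minimality of [generated] applies. *)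
Definition char_ker chi : set O := [set val w | w in [set w | ~~ chi w]].

Section CharKer.
Variable chi : W -> bool.
Hypothesis chiM : forall v w, chi (v * w)%g = chi v (+) chi w.

Lemma char_ker_val w : char_ker chi (val w) <-> ~~ chi w.
Proof. by split=> [[v vK /val_inj<-//]|wK]; exists w. Qed.

Lemma char_ker_refl s : S s -> char_ker chi (refl s) <-> ~~ chi (wrefl s).
Proof. by move=> Ss; rewrite -val_wrefl //; apply: char_ker_val. Qed.

Lemma char1 : chi 1%g = false.
Proof. by have := chiM 1%g 1%g; rewrite mulg1 addbb. Qed.

Lemma charV w : chi w^-1%g = chi w.
Proof. by have := chiM w^-1%g w; rewrite mulVg char1; do 2!case: (chi _). Qed.

Lemma char_ker_subgroup : subgroup (char_ker chi).
Proof.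
split.
- by exists 1%g; rewrite /= ?char1.
- move=> _ _ [v vK <-] [w wK <-]; exists (v * w)%g => //=.
  by rewrite chiM (negPf vK) (negPf wK).
by move=> _ [v vK <-]; exists v^-1%g; rewrite //= charV.
Qed.

Lemma char_ker_normal s g :
  S s -> char_ker chi g -> char_ker chi (refl s * g * refl s)%g.
Proof.
move=> Ss [w wK <-]; exists (wrefl s * w * wrefl s)%g; last first.
  by rewrite /= val_wrefl.
by rewrite /= !chiM addbC addbA addbb.
Qed.

End CharKer.

(** The kernel of the sum of the two characters is a subgroup stable under conjugation by
    reflections, so [reflections_normal_sub] puts every generator in it. *)
Lemma char_ext (T : set V0) chi chi' :
    (forall v w, chi (v * w)%g = chi v (+) chi w) ->
    (forall v w, chi' (v * w)%g = chi' v (+) chi' w) ->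
    (forall s, S s -> exists2 t, T t & congr2 S s t) -> T `<=` S ->
    (forall t, T t -> chi (wrefl t) = chi' (wrefl t)) ->
  chi =1 chi'.
Proof.
move=> chiM chi'M ST TS chiT w; pose d v := chi v (+) chi' v.
have dM u v : d (u * v)%g = d u (+) d v by rewrite /d chiM chi'M addbACA.
suff /char_ker_val : char_ker d (val w).
  by rewrite /d; case: (chi w); case: (chi' w).
have /set_mem := valP w; apply; first exact: char_ker_subgroup.
apply: reflections_normal_sub (ST) (TS) _ => //.
  exact: char_ker_normal.
move=> t Tt; apply/char_ker_refl; first exact: TS.
by rewrite /d chiT ?addbb.
Qed.

(** For roots, [form b a] is 2 or -2, so the isotropic part of [b] moves by an element of 2S, up to
    sign. *)
Lemma reflection_congr2 a b c : nonisotropic S a -> nonisotropic S b ->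
  inVt c = reflection a (inVt b) -> congr2 S c.2 b.2.
Proof.
move=> Sa Sb; rewrite reflectionE /wfun => /(congr1 (fun u => u.1.2)) /=.
rewrite /formt /Defs.form /= !lfunE /= !addr0 => ->.
have [s Ss [->|->]] : exists2 s, S s &
    2 * b.1 * a.1 *: a.2 = s *+ 2 \/ 2 * b.1 * a.1 *: a.2 = - (s *+ 2).
- move: Sa Sb; rewrite !nonisotropicE.
  move=> [] [s Ss <-] [] [t St <-]; exists s => //=;
  rewrite ?oppr0 !addr0 !add0r ?mulrN1 ?mulr1 ?opprK ?scaleNr scaler_nat; tauto.
- by exists (- s); [apply/ZspanN/sub_Zspan | rewrite mulNrn].
by exists s; [apply/sub_Zspan | rewrite opprK].
Qed.

Fact nonisotropic_shift s : S s -> alpha1 V0 + inV s \in nonisotropic S.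
Proof. by move=> Ss; apply: mem_set; rewrite nonisotropicE; left; exists s. Qed.

Definition root_of {s} (Ss : S s) : rootType S :=
  exist (fun a => a \in nonisotropic S) _ (nonisotropic_shift s Ss).

Section ClassParity.
Context {nu : nat} {sigma : 'I_nu -> V0}.
Hypothesis Sb : Zbasis sigma (Zspan S).
Variable g : {set {set 'I_nu}}.

Definition class_parity (a : rootType S) : bool :=
  `[< exists2 J, J \in g & congr2 S (val a).2 (tau sigma J) >].

Lemma class_parity_rel u v :
  conj_rel u v -> parity class_parity u = parity class_parity v.
Proof.
rewrite /parity => -[a|a b c abc].
  by rewrite !big_cons !big_nil addbF addbb.
rewrite !big_cons !big_nil !addbF addbCA addbb addbF.
have cb := reflection_congr2 _ _ _ (set_mem (valP a)) (set_mem (valP b)) abc.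
apply: asbool_equiv_eq; split=> -[J gJ J_]; exists J => //.
  exact: congr2_trans _ _ _ _ cb J_.
exact: congr2_trans _ _ _ _ (congr2_sym _ _ _ cb) J_.
Qed.

Definition class_char : conjGroup S -> bool := pres_parity class_parity.

Lemma class_charM x y : class_char (x * y)%g = class_char x (+) class_char y.
Proof. exact/pres_parityM/class_parity_rel. Qed.

Lemma class_char_gen J (SJ : S (tau sigma J)) :
  class_char (pres_gen (@conj_rel _ _ S) (root_of SJ)) = (J \in g).
Proof.
rewrite [LHS]pres_parity_gen; last exact: class_parity_rel.
rewrite /class_parity /= add0r; apply/asboolP/idP => [[K gK]|gJ].
  by move/(tau_congr2_inj Sb)->.
by exists J => //; apply: congr2_refl.
Qed.

End ClassParity.

Section Supp.
Context {nu : nat} {sigma : 'I_nu -> V0} {supp : {set {set 'I_nu}}}.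
Hypotheses (Sb : Zbasis sigma (Zspan S)) (Ssupp : is_supp S sigma supp).

Lemma supp_tau J : J \in supp <-> S (tau sigma J).
Proof.
have [_ SE] := Ssupp; split=> [PJ|].
  rewrite SE; exists J => //; exists 0; rewrite ?mul0rn ?addr0 //.
  exact: Zspan0.
rewrite {1}SE => -[K PK [v Sv JK]].
by rewrite (@tau_congr2_inj _ _ _ _ _ Sb J K) //; exists v.
Qed.

Lemma supp_congr2 s : S s -> exists2 t, [set tau sigma J | J in [set` supp]] t
  & congr2 S s t.
Proof.
have [_ SE] := Ssupp; rewrite {1}SE => -[J PJ [v Sv <-]].
by exists (tau sigma J); [exists J | exists v].
Qed.

(* [chi] ranges over the pullbacks by [f] of the class characters: restriction *)
(* to supp(S) is injective on these, hence surjective by counting.             *)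
Lemma supp_char (f : {multiplicative W -> conjGroup S})
    (P : {set {set 'I_nu}}) :
    bijective f -> (P \subset supp)%SET -> exists2 chi : W -> bool,
    forall v w, chi (v * w)%g = chi v (+) chi w
  & forall J, J \in supp -> chi (wrefl (tau sigma J)) = (J \in P).
Proof.
move=> [h fK hK] Psupp.
pose chi g w := class_char (sigma := sigma) g (f w).
have chiM g v w : chi g (v * w)%g = chi g v (+) chi g w.
  by rewrite /chi gmulfM class_charM.
pose F g := [set J in supp | chi g (wrefl (tau sigma J))]%SET.
have FP g : F g \in powerset supp.
  by rewrite inE; apply/fintype.subsetP => J; rewrite inE => /andP[].
have F_inj : {in powerset supp &, injective F}.
  move=> g g'; rewrite !inE => gP g'P Fgg'.
  have {Fgg'}chi_eq : chi g =1 chi g'.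
    apply: (@char_ext [set tau sigma J | J in [set` supp]]) => //.
    - exact: supp_congr2.
    - by move=> _ [J PJ <-]; apply/supp_tau.
    move=> _ [J PJ <-]; have /finset.setP/(_ J) := Fgg'.
    by rewrite !inE [J \in supp]PJ.
  apply/finset.setP => J; case PJ : (J \in supp); last first.
    have notin (A : {set {set 'I_nu}}) :
        (A \subset supp)%SET -> (J \in A) = false.
      by move=> /fintype.subsetP AP; apply: contraFF PJ; apply: AP.
    by rewrite !notin.
  have SJ : S (tau sigma J) by apply/supp_tau.
  (* The preimage under [f] of the generator for J need not be a reflection; only the equality of
     the two characters on all of W is used. *)
  have := chi_eq (h (pres_gen (@conj_rel _ _ S) (root_of SJ))).
  by rewrite /chi hK !class_char_gen.
have : P \in (F @: powerset supp)%SET.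
  have /eqP-> : (F @: powerset supp == powerset supp)%SET.
    rewrite eqEcard card_in_imset // leqnn andbT.
    by apply/fintype.subsetP => _ /imsetP[g _ ->].
  by rewrite inE.
move=> /imsetP[g _ ->]; exists (chi g) => // J PJ.
by rewrite inE PJ.
Qed.

Lemma pairs_not_presented (J : {set 'I_nu}) : J \in Esupp supp ->
    (forall i, i \in J -> [set i]%SET \in supp) ->
    (forall i j, i \in J -> j \in J -> i != j -> [set i; j]%SET \in supp) ->
  ~ presentation_by_conjugation S.
Proof.
rewrite inE => /andP[PJ J3] J1 J2 [f f_bij].
(* The character that is nontrivial at J and at no other member of supp(S). *)
have [|chi chiM chiE] := @supp_char f [set J]%SET f_bij.
  by rewrite finset.sub1set.
have sgK := char_ker_subgroup _ chiM.
have small K : K \in supp -> (#|K| < 3)%N -> char_ker chi (refl (tau sigma K)).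
  move=> PK K3; apply/char_ker_refl; first exact/supp_tau.
  by rewrite chiE // inE; apply: contraTneq K3 => ->; rewrite -leqNgt.
have SJ : S (tau sigma J) by apply/supp_tau.
suff /(char_ker_refl _ _ SJ) : char_ker chi (refl (tau sigma J)).
  by rewrite chiE // inE eqxx.
apply: refl_sum => //.
- have -> : 0 = tau sigma finset.set0 by rewrite /tau big_set0.
  by apply: small; rewrite ?cards0 //; have [] := Ssupp.
- move=> i iJ.
  have -> : sigma i = tau sigma [set i]%SET by rewrite /tau big_set1.
  by apply: small; rewrite ?cards1 //; apply: J1.
move=> i j iJ jJ ij.
have -> : sigma i + sigma j = tau sigma [set i; j]%SET.
  by rewrite /tau big_setU1 ?inE //= big_set1.
by apply: small; rewrite ?cards2 ?ij //; apply: J2.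
Qed.

End Supp.
End Characters.

(** * The three cases of the theorem *)

Lemma exists_card_subset (T : finType) (A : {set T}) n :
  (n <= #|A|)%N -> exists2 B : {set T}, B \subset A & #|B| = n.
Proof.
move=> nA; exists [set x in take n (enum A)]%SET.
  by apply/fintype.subsetP => x; rewrite inE => /mem_take; rewrite mem_enum.
rewrite cardsE (card_uniqP _) ?take_uniq ?enum_uniq //.
by rewrite size_takel -?cardE.
Qed.

Theorem corollary5p17 (R : realType) (V0 : vectType R) (nu : nat)
    (S : set V0) (sigma : 'I_nu -> V0) (supp : {set {set 'I_nu}}) :
  \dim {: V0} = nu ->
  semilattice S ->
  Zbasis sigma (Zspan S) ->
  (forall i, S (sigma i)) ->
  is_supp S sigma supp ->
  [\/ exists2 J : {set 'I_nu}, J \in Esupp supp &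
        forall r s : 'I_nu, r \in J -> s \in J -> [set r; s]%SET \in supp,
      lattice S /\ (3 <= nu)%N
    | (3 < nu)%N /\ ind supp = (2 ^ nu - 2)%N] ->
  ~ presentation_by_conjugation S.
Proof.
move=> _ Ssl Sb Ssigma Ssupp; have [set0P _] := Ssupp.
have subsets_in_supp (J : {set 'I_nu}) : (3 <= #|J|)%N ->
    (forall K : {set 'I_nu}, K \subset J -> K \in supp) ->
    ~ presentation_by_conjugation S.
  move=> J3 KJ; apply: (@pairs_not_presented _ _ _ Ssl _ _ _ Sb Ssupp J).
  - by rewrite inE KJ.
  - by move=> i iJ; apply: KJ; rewrite finset.sub1set.
  - by move=> i j iJ jJ _; apply: KJ; rewrite finset.subUset !finset.sub1set iJ.
case=> [[J EJ J2]|[[_ SD] nu3]|[nu4 ind_supp]].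
- apply: (@pairs_not_presented _ _ _ Ssl _ _ _ Sb Ssupp J EJ).
    (* Taking r = s in the hypothesis gives the singletons. *)
    by move=> i iJ; have := J2 i i iJ iJ; rewrite finset.setUid.
  by move=> r s rJ sJ _; apply: J2.
- apply: (subsets_in_supp [set: 'I_nu]) => [|K _].
    by rewrite cardsT card_ord.
  apply/(supp_tau Sb Ssupp); apply: (big_ind S) => //.
    by case: Ssl.
  by move=> s t Ss St; have [] := SD s t Ss St.
have /cards1P[M suppC] : #|~: supp| == 1%N.
  (* Positivity makes the truncated subtraction in [ind] exact, so supp(S) has 2^nu - 1 members. *)
  have supp0 : (0 < #|supp|)%N by apply/card_gt0P; exists finset.set0.
  have := cardsC supp; rewrite -cardsT -powersetT card_powerset cardsT card_ord.
  have : (2 <= 2 ^ nu)%N by rewrite -{1}(expn1 2) leq_pexp2l //; lia.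
  move: ind_supp; rewrite /ind; lia.
have in_supp K : K != M -> K \in supp.
  move=> KM; have := finset.in_setC K supp.
  by rewrite suppC inE (negPf KM); case: (K \in supp).
have [a aM] : exists a, a \in M.
  apply/finset.set0Pn/eqP => M0; have : M \in ~: supp by rewrite suppC inE.
  by rewrite inE M0 set0P.
(* Since nu > 3, three indices remain besides [a]; no subset of J contains [a], so none equals M. *)
have [|J Ja J3] := @exists_card_subset _ [set~ a] 3.
  by rewrite cardsC1 card_ord; lia.
apply: (subsets_in_supp J) => [|K KJ]; first by rewrite J3.
apply: in_supp; apply: contraTneq aM => <-; apply/negP => aK.
by have := fintype.subsetP Ja a (fintype.subsetP KJ a aK); rewrite !inE eqxx.
Qed.
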